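(* Let $1\le d\le N$ be integers, $t>0$, and $z=e^{-t/2}$. The microchiral partition function $Z_N^d$ of two-dimensional Yang--Mills theory with gauge group $\mathrm{U}_N$ on a torus of area $t$ admits the absolutely convergent series expansion $$Z_N^d=\frac{z^d}{d!}\sum_{r=0}^\infty\frac{(-t)^r}{r!\,N^r}\langle HK^r\rangle,$$ where $\langle HK^r\rangle$ is a simple Hurwitz number with torus target, i.e. the number of tuples $(\rho,\sigma,\tau_1,\dots,\tau_r)$ of permutations in $\mathrm{S}^d$, with $\rho,\sigma$ arbitrary and $\tau_1,\dots,\tau_r$ transpositions, such that $\rho^{-1}\sigma^{-1}\rho\sigma\tau_1\cdots\tau_r$ is the identity.
   Context: $\mathsf{Y}^d_N$ is the set of Young diagrams with exactly $d$ cells and at most $N$ rows. For $\lambda\in\mathsf{Y}^d_N$, $\hat C(\lambda)=\sum_{i=1}^N\lambda_i(\lambda_i+N+1-2i)$ is the eigenvalue of the quadratic Casimir in the irreducible representation of $\mathrm{U}_N$ with highest weight $\lambda$. The microchiral partition function of the torus (no holes, one handle) is $$Z_N^d=\sum_{\lambda\in\mathsf{Y}^d_N}e^{-\frac{t}{2N}\hat C(\lambda)}.$$ In the group algebra $\mathbb{C}\mathrm{S}^d$ of the symmetric group, $K$ is the sum of all transpositions and $H=\sum_{\rho,\sigma\in\mathrm{S}^d}\rho^{-1}\sigma^{-1}\rho\sigma$ is the commutator sum. For $A\in\mathbb{C}\mathrm{S}^d$, $\langle A\rangle$ denotes the coefficient of the identity permutation in $A$. *)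

(* Defs.v *)
From HB Require Import structures.
From mathcomp Require Import all_boot all_order all_algebra all_fingroup.
From mathcomp Require Import mxrepresentation complex.
From mathcomp Require Import all_classical all_reals all_analysis.

Set Implicit Arguments.
Unset Strict Implicit.
Unset Printing Implicit Defensive.

Import Order.TTheory GRing.Theory Num.Theory.
Import numFieldNormedType.Exports.

Local Open Scope ring_scope.
Local Open Scope complex_scope.

(* The complex numbers, seen as a [numClosedFieldType] so that the generic
   topology of a [numFieldType] is inferred on them. *)
Definition Cplx (R : realType) : numClosedFieldType := R[i].

Definition CofR (R : realType) (x : R) : Cplx R := x%:C.

(* A Young diagram with [d] cells and at most [N] rows is given by its row
   lengths, padded with zeros to length [N]; the row [i : 'I_N] is the
   [i.+1]-st one.  Row lengths are at most [d], which gives a finite type. *)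
Definition is_young (d N : nat) (l : {ffun 'I_N -> 'I_d.+1}) : bool :=
  [forall i : 'I_N, forall j : 'I_N, (i <= j)%N ==> (l j <= l i)%N] &&
  (\sum_(i < N) l i == d)%N.

Definition young (d N : nat) : {set {ffun 'I_N -> 'I_d.+1}} :=
  [set l | is_young l].

Definition casimir (d N : nat) (l : {ffun 'I_N -> 'I_d.+1}) : int :=
  \sum_(i < N) (l i)%:Z * ((l i)%:Z + N%:Z + 1 - 2 * i.+1%:Z).

Definition microchiral (R : realType) (d N : nat) (t : R) : R :=
  \sum_(l in young d N) expR (- (t / (2 * N%:R)) * (casimir l)%:~R).

Definition is_transposition (d : nat) (s : 'S_d) : bool :=
  [exists i : 'I_d, exists j : 'I_d, (i != j) && (s == tperm i j)].

Section GroupAlgebra.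
Variables (R : realType) (d : nat).

(* Elements of the group algebra are encoded as in [mxrepresentation], by
   matrices in [group_ring]: a permutation [s] becomes the matrix [gelt s] of
   the regular representation, the product of the algebra becomes the matrix
   product, and [gring_proj s A] is the 1 x 1 matrix holding the coefficient
   of [s] in [A]. *)
Definition Sgrp : {group 'S_d} := [set: 'S_d]%G.

Definition gelt (s : 'S_d) : 'M[Cplx R]_#|Sgrp| := regular_repr (Cplx R) Sgrp s.

Definition Ksum : 'M[Cplx R]_#|Sgrp| :=
  \sum_(s : 'S_d | is_transposition s) gelt s.

Definition Hsum : 'M[Cplx R]_#|Sgrp| :=
  \sum_(rho : 'S_d) \sum_(sigma : 'S_d)
    gelt (rho^-1 * sigma^-1 * rho * sigma)%g.

Definition idcoef (A : 'M[Cplx R]_#|Sgrp|) : Cplx R :=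
  gring_proj 1%g A 0 0.

Lemma gelt_group_ring s : (gelt s \in group_ring (Cplx R) Sgrp)%MS.
Proof. by apply: envelop_mx_id; rewrite inE. Qed.

Lemma geltM s s' : gelt (s * s')%g = gelt s *m gelt s'.
Proof. by rewrite /gelt repr_mxM ?inE. Qed.

Lemma idcoef_gelt s : idcoef (gelt s) = (s == 1%g)%:R.
Proof.
by rewrite /idcoef gring_projE ?inE // eq_sym; case: eqP; rewrite ?mxE.
Qed.

Lemma idcoef_lin (A B : 'M[Cplx R]_#|Sgrp|) (c : Cplx R) :
  idcoef (c *: A + B) = c * idcoef A + idcoef B.
Proof. by rewrite /idcoef linearP !mxE. Qed.

Lemma Ksum_group_ring : (Ksum \in group_ring (Cplx R) Sgrp)%MS.
Proof.
by rewrite /Ksum linear_sum summx_sub // => s _; apply: gelt_group_ring.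
Qed.

Lemma Hsum_group_ring : (Hsum \in group_ring (Cplx R) Sgrp)%MS.
Proof.
rewrite /Hsum linear_sum summx_sub // => s _.
by rewrite linear_sum summx_sub // => s' _; apply: gelt_group_ring.
Qed.

End GroupAlgebra.

Arguments Ksum R d : clear implicits.
Arguments Hsum R d : clear implicits.

Definition hurwitz_tuples (d r : nat) :
    {set ('S_d * 'S_d) * r.-tuple 'S_d} :=
  [set x : ('S_d * 'S_d) * r.-tuple 'S_d |
    let: (rho, sigma, tau) := x in
    all (@is_transposition d) tau &&
    (rho^-1 * sigma^-1 * rho * sigma * \prod_(i < r) tnth tau i == 1)%g].

Definition simple_hurwitz (d r : nat) : nat := #|hurwitz_tuples d r|.

(* Main.v *)
(* The coefficient <H K^r> is d! times the trace of K^r on the class functions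
   of S_d, because summing over rho and sigma averages over conjugacy classes.
   A basis of class functions is given by the permutation characters of S_d on
   the words of prescribed content l, for l a partition of d: N >= d letters
   suffice.  In this basis K is triangular for the order by sum l_i^2: if tau
   is the transposition of p and q, a word is fixed by tau g when either it is
   fixed by g and has equal letters at p and q, or g exchanges the letters at p
   and q; the words of the second kind are counted by a telescoping double
   count, which only involves contents with a larger sum of squares and
   contributes - sum (i-1) l_i to the diagonal.  Hence the trace of K^r is the
   sum over l of the r-th powers of the content sums c(l), and since
   C(l) = N d + 2 c(l), summing the exponential series gives the theorem. *)
Require Import Defs.
From HB Require Import structures.
From mathcomp Require Import all_boot all_order all_algebra all_fingroup.
From mathcomp Require Import mxrepresentation complex.
From mathcomp Require Import all_classical all_reals all_analysis.
From mathcomp Require Import zify ring.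

Set Implicit Arguments.
Unset Strict Implicit.
Unset Printing Implicit Defensive.

Import Order.TTheory GRing.Theory Num.Theory.
Import numFieldNormedType.Exports.

Local Open Scope ring_scope.

(** * Permutation characters on words *)

Section Words.
Variables T L : finType.
Implicit Types (w : {ffun T -> L}) (g : {perm T}) (a : L -> nat) (i j l : L).

Definition wcontent w l : nat := #|[set x | w x == l]|.

Definition words a : {set {ffun T -> L}} :=
  [set w | [forall l, wcontent w l == a l]].

Definition fixed_word g w : bool := [forall x, w (g x) == w x].

(** When the values of [a] add up to [#|T|], this is the character of [{perm T}] on the cosets of a
    Young subgroup of type [a]. *)
Definition perm_char a g : nat := (\sum_(w in words a) fixed_word g w)%N.

Lemma wcontentE w l : wcontent w l = (\sum_x (w x == l))%N.
Proof. by rewrite /wcontent cardsE -sum1_card big_mkcond. Qed.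

Lemma wordsP a w : reflect (wcontent w =1 a) (w \in words a).
Proof. by rewrite inE; apply: (iffP forallP) => h l; apply/eqP; rewrite h. Qed.

Lemma eq_words a b : a =1 b -> words a = words b.
Proof.
move=> ab; apply/setP => w; apply/wordsP/wordsP => h l; rewrite h ?ab //.
Qed.

Lemma eq_perm_char a b g : a =1 b -> perm_char a g = perm_char b g.
Proof. by move=> /eq_words ab; rewrite /perm_char ab. Qed.

Lemma fixed_wordP g w : reflect (forall x, w (g x) = w x) (fixed_word g w).
Proof. by apply: (iffP forallP) => h x; apply/eqP; rewrite h. Qed.

Definition put w (p : T) l : {ffun T -> L} := [ffun x => if x == p then l else w x].

Lemma wcontent_put w p l' l :
  (wcontent (put w p l') l + (w p == l) = wcontent w l + (l' == l))%N.
Proof.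
rewrite !wcontentE (bigD1 p) //= [in RHS](bigD1 p) //= ffunE eqxx.
rewrite (eq_bigr (fun x => (w x == l) : nat)); last first.
  by move=> x xp; rewrite ffunE (negPf xp).
by rewrite addnC addnA [RHS]addnAC.
Qed.

Definition merge i j w : {ffun T -> L} := [ffun x => if w x == j then i else w x].

(** If the word with [i] and [j] merged is fixed by [g], the defect collects the positions where [w]
    has [i] and [w \o g] has [j]; it measures how far [w] is from being fixed. *)
Definition defect g j w : {set T} := [set x | (w (g x) == j) && (w x != j)].

Lemma sum_sub1 (B D : {set T}) : D \subset B ->
  (\sum_(x in B) (D \subset [set x]) = #|B| * (#|D| == 0) + (#|D| == 1))%N.
Proof.
move=> DB; have [/cards1P[y Dy]|D1] := boolP (#|D| == 1%N).
  have yB : y \in B by rewrite (fintype.subsetP DB) // Dy set11.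
  rewrite Dy cards1 muln0 (bigD1 y) //= subxx big1 // => x /andP[_ xy].
  by rewrite finset.sub1set inE eq_sym (negPf xy).
rewrite addn0 -sum1_card big_distrl /=; apply: eq_bigr => x _.
rewrite mul1n finset.subset1 cards_eq0; case: (altP (D =P [set x])) => // Dx.
by rewrite Dx cards1 in D1.
Qed.

(** An empty defect puts the [g]-preimage of the level set of [j] inside that level set. Both have
    the same size, so they coincide, and the merged word controls the other letters. *)
Lemma fixed_merge g i j w : i != j ->
  fixed_word g w = fixed_word g (merge i j w) && (#|defect g j w| == 0)%N.
Proof.
move=> ij; apply/fixed_wordP/andP.
  move=> h; split; first by apply/fixed_wordP => x; rewrite !ffunE h.
  by rewrite cards_eq0; apply/eqP/setP => x; rewrite !inE h andbN.
case=> /fixed_wordP h; rewrite cards_eq0 => /eqP/setP D0 x.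
have sub y : w (g y) == j -> w y == j.
  by move=> gy; have := D0 y; rewrite !inE gy /= => /negbFE.
have eqX : [set y | w (g y) == j] = [set y | w y == j].
  apply/eqP; rewrite eqEcard; apply/andP; split.
    by apply/fintype.subsetP => y; rewrite !inE; apply: sub.
  have -> : [set y | w (g y) == j] = g @^-1: [set y | w y == j].
    by apply/setP => y; rewrite !inE.
  by rewrite on_card_preimset //; exists (g^-1)%g => y _; rewrite ?permK ?permKV.
have /setP/(_ x) := eqX; rewrite !inE => e.
have := h x; rewrite !ffunE e; case: eqP => // wx.
by move: e; rewrite wx eqxx => /eqP.
Qed.

(* Equivalently, [w \o g] is [w] with one letter [i] and one letter [j] exchanged. *)
Definition quasi_fixed g i j w : bool :=
  fixed_word g (merge i j w) && (#|defect g j w| == 1)%N.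

Definition quasi_char i j a g : nat := (\sum_(w in words a) quasi_fixed g i j w)%N.

(** When the merged word is fixed, the defect lies in the level set of [i]. By [sum_sub1] an empty
    defect then counts once for each [p], and a one-point defect counts once in all. *)
Lemma sum_put g i j w : i != j ->
  (\sum_(p | w p == i) (fixed_word g (merge i j w) && (defect g j w \subset [set p]))
   = wcontent w i * fixed_word g w + quasi_fixed g i j w)%N.
Proof.
move=> ij; rewrite (fixed_merge g w ij) /quasi_fixed.
case: (fixed_wordP g (merge i j w)) => [h|_] /=; last by rewrite big1 // muln0.
rewrite /wcontent -sum_sub1; first by apply: eq_bigl => x; rewrite inE.
apply/fintype.subsetP => x; rewrite !inE => /andP[/eqP gx xj].
by have := h x; rewrite !ffunE gx eqxx (negPf xj) => ->.
Qed.

(** Here the defect is seen inside the [g]-preimage of the level set of [j], which has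
    [wcontent w j] points; this explains the index [(g^-1)%g p]. *)
Lemma sum_take g i j w : i != j ->
  (\sum_(p | w p == j)
     (fixed_word g (merge i j w) && (defect g j w \subset [set (g^-1)%g p]))
   = wcontent w j * fixed_word g w + quasi_fixed g i j w)%N.
Proof.
move=> ij; rewrite (fixed_merge g w ij) /quasi_fixed.
case: (fixed_wordP g (merge i j w)) => [h|_] /=; last by rewrite big1 // muln0.
have -> : wcontent w j = #|[set x | w (g x) == j]|.
  have -> : [set y | w (g y) == j] = g @^-1: [set y | w y == j].
    by apply/setP => y; rewrite !inE.
  by rewrite on_card_preimset //; exists (g^-1)%g => y _; rewrite ?permK ?permKV.
rewrite -sum_sub1; last by apply/fintype.subsetP => x; rewrite !inE => /andP[].
rewrite (reindex_inj (@perm_inj _ g)) /=.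
by apply: eq_big => x; rewrite ?inE // permK.
Qed.

(** The new letter at [p] does not change the merged word. The two defects agree away from [p] and
    [(g^-1)%g p]; the old one misses [(g^-1)%g p] and the new one misses [p]. *)
Lemma put_cond g i j w p : i != j -> w p == i ->
  fixed_word g (merge i j w) && (defect g j w \subset [set p]) =
  fixed_word g (merge i j (put w p j)) &&
    (defect g j (put w p j) \subset [set (g^-1)%g p]).
Proof.
move=> ij /eqP wp; congr andb.
  congr fixed_word; apply/ffunP => x; rewrite !ffunE.
  by case: (altP (x =P p)) => [->|] //; rewrite wp (negPf ij) eqxx.
have e x : (x == (g^-1)%g p) = (g x == p).
  by rewrite -(inj_eq (@perm_inj _ g)) permKV.
apply/fintype.subsetP/fintype.subsetP => h x; have := h x; rewrite !inE !ffunE e.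
  case: (altP (g x =P p)) => // _ {}h /andP[h1 h2]; move: h h2.
  by rewrite h1; case: (altP (x =P p)) => /= [_ _|_ h /h //]; rewrite eqxx.
case: (altP (x =P p)) => //= xp {}h /andP[h1 h2]; move: h; rewrite h2 andbT.
case: (altP (g x =P p)) => [gx|_ /(_ h1)//].
by move: h1; rewrite gx wp (negPf ij).
Qed.

(* Both sides count the pairs [(w, p)] such that the occurrences of [j] in [w]
   become [g]-stable, up to one point, when the letter [i] at [p] is replaced
   by [j]. *)
Lemma quasi_char_step g i j a b : i != j -> (0 < a i)%N ->
    (forall l, b l + (i == l) = a l + (j == l))%N ->
  (a i * perm_char a g + quasi_char i j a g =
   b j * perm_char b g + quasi_char i j b g)%N.
Proof.
move=> ij ai ab; rewrite /perm_char /quasi_char !big_distrr -!big_split /=.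
under eq_bigr => w /wordsP h do rewrite -h -sum_put //.
under [RHS]eq_bigr => w /wordsP h do rewrite -h -sum_take //.
rewrite !pair_big_dep /=.
rewrite (reindex_onto (fun wp => (put wp.1 wp.2 i, wp.2))
  (fun wp => (put wp.1 wp.2 j, wp.2))) /=; last first.
  case=> w p /= /andP[_ /eqP wp]; congr (_, _); apply/ffunP => x.
  by rewrite !ffunE; case: eqP => // ->.
apply: eq_big => [[w p] /=|[w p] /=].
  rewrite !ffunE !eqxx andbT xpair_eqE eqxx andbT.
  have -> : (put (put w p i) p j == w) = (w p == j).
    apply/eqP/eqP => [<-|wp]; first by rewrite ffunE eqxx.
    by apply/ffunP => x; rewrite !ffunE; case: eqP => // ->.
  case: (altP (w p =P j)) => wp; rewrite ?andbF // !andbT.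
  apply/wordsP/wordsP => h l; have := wcontent_put w p i l; rewrite wp.
    by rewrite h; have := ab l; lia.
  by rewrite h; have := ab l; lia.
move=> /andP[_ /eqP [wp]].
by rewrite put_cond ?wp // ffunE eqxx.
Qed.

End Words.

Section PermChar.
Variables T L : finType.
Implicit Types (w : {ffun T -> L}) (g h : {perm T}) (a : L -> nat) (i j l : L).

Lemma perm_char_conj a g h : perm_char a (g ^ h)%g = perm_char a g.
Proof.
pose c (k : {perm T}) w := [ffun x => w (k x)].
have cK k : cancel (c k) (c (k^-1)%g).
  by move=> w; apply/ffunP => x; rewrite !ffunE permKV.
have cW k w : (c k w \in words T a) = (w \in words T a).
  suff e l : wcontent (c k w) l = wcontent w l.
    by apply/wordsP/wordsP => H l; rewrite -?H e.
  by rewrite !wcontentE [RHS](reindex_inj (@perm_inj _ k)); apply: eq_bigr => x _; rewrite ffunE.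
rewrite /perm_char [RHS](reindex (c h)); last first.
  exists (c (h^-1)%g) => w _; first exact: cK.
  by have := cK (h^-1)%g w; rewrite invgK.
apply: eq_big => [w|w _]; first by rewrite cW.
congr nat_of_bool; apply/fixed_wordP/fixed_wordP => H x.
  by rewrite !ffunE -permJ H.
by have := H ((h^-1)%g x); rewrite !ffunE -permJ permKV.
Qed.

(** Renaming letters is a bijection on words that respects being fixed. Hence contents may be
    sorted, and only Young diagrams matter. *)
Lemma perm_char_letters a g (p : {perm L}) : perm_char (a \o p) g = perm_char a g.
Proof.
pose c (q : {perm L}) w := [ffun x => q (w x)].
have cK q : cancel (c q) (c (q^-1)%g).
  by move=> w; apply/ffunP => x; rewrite !ffunE permK.
rewrite /perm_char [RHS](reindex (c p)); last first.
  exists (c (p^-1)%g) => w _; first exact: cK.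
  by have := cK (p^-1)%g w; rewrite invgK.
have e w l : wcontent (c p w) (p l) = wcontent w l.
  by rewrite !wcontentE; apply: eq_bigr => x _; rewrite ffunE (inj_eq perm_inj).
apply: eq_big => [w|w _].
  apply/wordsP/wordsP => H l /=; last by rewrite -H e.
  by rewrite -[l](permKV p) e H.
congr nat_of_bool; apply/fixed_wordP/fixed_wordP => H x.
  by rewrite !ffunE H.
by have := H x; rewrite !ffunE => /perm_inj.
Qed.

(* Moves letters between [i] and [j]: there are [k] letters [j] and [s - k]
   letters [i] left. *)
Definition shift a i j (s k : nat) : L -> nat :=
  fun l => if l == i then (s - k)%N else if l == j then k else a l.

(** Telescoping of [quasi_char_step]: going from [k] to [k + 1] letters [j] contributes
    [(s - k) - k] times the character at [k]. The sum starts from zero letters [j], where no word is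
    quasi-fixed. *)
Lemma quasi_char_shift (R : comNzRingType) g i j a s n : i != j -> (n <= s)%N ->
  (quasi_char i j (shift a i j s n) g)%:R +
    n%:R * (perm_char (shift a i j s n) g)%:R =
  \sum_(k < n) (s%:R - k%:R *+ 2) * (perm_char (shift a i j s k) g)%:R :> R.
Proof.
move=> ij; elim: n => [_|n IHn ns].
  rewrite big_ord0 mul0r addr0 /quasi_char big1 // => w /wordsP H.
  rewrite /quasi_fixed (_ : defect g j w = finset.set0) ?cards0 ?andbF //.
  have := H j; rewrite /shift eqxx eq_sym (negPf ij) => /eqP.
  rewrite /wcontent cards_eq0 => /eqP/setP H0.
  by apply/setP => x; have := H0 (g x); rewrite !inE => ->.
rewrite big_ord_recr /= -IHn; last exact: ltnW.
have ji : j != i by rewrite eq_sym.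
have : (shift a i j s n i * perm_char (shift a i j s n) g +
    quasi_char i j (shift a i j s n) g =
  shift a i j s n.+1 j * perm_char (shift a i j s n.+1) g +
    quasi_char i j (shift a i j s n.+1) g)%N.
  apply: quasi_char_step; rewrite // /shift ?eqxx ?subn_gt0 // => l.
  rewrite ![_ == l]eq_sym; case: (altP (l =P i)) => [->|]; rewrite ?(negPf ij).
    by rewrite addn0 addn1 -subSn // subSS.
  by case: (l == j); rewrite ?addn0 ?addn1.
rewrite /shift !eqxx (negPf ji) -/(shift a i j s n) -/(shift a i j s n.+1).
move=> /(congr1 (fun m => m%:R : R)); rewrite !natrD !natrM natrB; last exact: ltnW.
by move=> e; apply: etrans (etrans (esym e) _); ring.
Qed.

(** * Words in which two positions are exchanged *)

Section Transpositions.
Variables (g : {perm T}) (w : {ffun T -> L}).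

Lemma sum_set1 (B D : {set T}) : D \subset B ->
  (\sum_(x in B) (D == [set x]) = (#|D| == 1))%N.
Proof.
move=> DB; have [/cards1P[y Dy]|D1] := boolP (#|D| == 1%N).
  have yB : y \in B by rewrite (fintype.subsetP DB) // Dy set11.
  rewrite Dy (bigD1 y) //= eqxx big1 // => x /andP[_ xy].
  by rewrite (inj_eq (@finset.set1_inj _)) eq_sym (negPf xy).
by apply: big1 => x _; case: eqP => // Dx; rewrite Dx cards1 in D1.
Qed.

Lemma swap_fixedE i j (p q : T) : i != j -> w p = i -> w q = j ->
  [forall x, w (g x) == w (tperm p q x)] =
  [&& fixed_word g (merge i j w), defect g j w == [set p] &
      [set x | (w x == j) && (w (g x) != j)] == [set q]].
Proof.
move=> ij wp wq; have ji : j != i by rewrite eq_sym.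
apply/forallP/and3P.
  move=> H; split.
  - apply/fixed_wordP => x; rewrite !ffunE (eqP (H x)).
    by case: tpermP => [->|->|]; rewrite ?wp ?wq ?eqxx ?(negPf ij).
  - apply/eqP/setP => x; rewrite !inE (eqP (H x)).
    case: tpermP => [->|->|xp xq]; rewrite ?wp ?wq ?eqxx ?andbF ?ij //.
      by apply/esym/eqP => qp; move: ij; rewrite -wp -wq qp eqxx.
    by rewrite andbN; apply/esym/eqP.
  - apply/eqP/setP => x; rewrite !inE (eqP (H x)).
    case: tpermP => [->|->|xp xq]; rewrite ?wp ?wq ?eqxx ?(negPf ij) ?ij //=.
      by apply/esym/eqP => qp; move: ij; rewrite -wp -wq qp eqxx.
    by rewrite andbN; apply/esym/eqP.
case=> /fixed_wordP H /eqP/setP D /eqP/setP D' x; apply/eqP.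
have := H x; have := D x; have := D' x; rewrite !inE !ffunE.
case: tpermP => [->|->|xp xq].
- by rewrite eqxx wp wq => _ /andP[/eqP].
- by rewrite eqxx wp wq eqxx => /andP[_ /negPf ->] _.
move/eqP: xp => /negPf ->; move/eqP: xq => /negPf ->.
by case: eqP => [->|_]; case: eqP => // ->.
Qed.

(** Since [g] preserves cardinality, [j] appears at as many positions as it disappears from. A
    quasi-fixed word therefore determines exactly one pair [(p, q)], and any other word none. *)
Lemma sum_swap_fixed i j : i != j ->
  (\sum_(p | w p == i) \sum_(q | w q == j)
     [forall x, w (g x) == w (tperm p q x)] = quasi_fixed g i j w)%N.
Proof.
move=> ij; pose D := defect g j w.
pose D' := [set x | (w x == j) && (w (g x) != j)].
have DD' : #|D'| = #|D|.
  pose X := [set x | w x == j]; pose X' := [set x | w (g x) == j].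
  have -> : D' = X :\: X' by apply/setP => x; rewrite !inE andbC.
  have -> : D = X' :\: X by apply/setP => x; rewrite !inE andbC.
  rewrite !cardsD finset.setIC; congr (_ - _)%N.
  have -> : X' = g @^-1: X by apply/setP => x; rewrite !inE.
  by rewrite on_card_preimset //; exists (g^-1)%g => y _; rewrite ?permK ?permKV.
transitivity (\sum_(p | w p == i)
    (fixed_word g (merge i j w) && (D == [set p])) * (#|D| == 1))%N.
  apply: eq_bigr => p /eqP wp; rewrite -DD' -(@sum_set1 [set q | w q == j]).
    rewrite big_distrr /=; apply: eq_big => [q|q /eqP wq]; first by rewrite inE.
    by rewrite (@swap_fixedE i j) // andbA mulnb.
  by apply/fintype.subsetP => x; rewrite !inE => /andP[].
rewrite -big_distrl /= /quasi_fixed -/D.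
case: (fixed_wordP g (merge i j w)) => [h|_] /=; last by rewrite big1.
rewrite (eq_bigl [in [set p | w p == i]]); last by move=> p; rewrite inE.
rewrite sum_set1 ?mulnb ?andbb //.
apply/fintype.subsetP => x; rewrite !inE => /andP[/eqP gx xj].
by have := h x; rewrite !ffunE gx eqxx (negPf xj) => ->.
Qed.

Lemma sum_swap_eq :
  (\sum_p \sum_(q | (q != p) && (w q == w p)) [forall x, w (g x) == w (tperm p q x)]
   = (\sum_l wcontent w l * (wcontent w l).-1) * fixed_word g w)%N.
Proof.
rewrite big_distrl /= (partition_big w predT) //=; apply: eq_bigr => l _.
rewrite {1}/wcontent -sum1_card !big_distrl /=; apply: eq_big => p; first by rewrite inE.
move=> /eqP wp; rewrite mul1n (eq_bigr (fun=> fixed_word g w : nat)).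
  rewrite sum_nat_const; congr (_ * _)%N.
  by rewrite /wcontent (cardsD1 p) inE wp eqxx /=; apply: eq_card => q; rewrite !inE.
move=> q /andP[_ /eqP wq]; congr nat_of_bool; rewrite /fixed_word.
apply: eq_forallb => x; case: tpermP => [->|->|//]; first by rewrite wq.
by rewrite wq.
Qed.
End Transpositions.

Lemma sum_swap_neq g w :
  (\sum_p \sum_(q | w q != w p) [forall x, w (g x) == w (tperm p q x)]
   = \sum_i \sum_(j | i != j) quasi_fixed g i j w)%N.
Proof.
rewrite (partition_big w predT) //=; apply: eq_bigr => i _.
rewrite (eq_bigr (fun p => \sum_(j | i != j) \sum_(q | w q == j)
   [forall x, w (g x) == w (tperm p q x)])%N) => [|p /eqP <-].
  rewrite exchange_big /=; apply: eq_bigr => j ij; exact: sum_swap_fixed.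
rewrite (partition_big w (fun j => w p != j)) /=; last by move=> q; rewrite eq_sym.
apply: eq_bigr => j pj; apply: eq_bigl => q.
by case: (altP (w q =P j)) => [->|_]; rewrite ?andbF // eq_sym pj.
Qed.

(** For each word the pairs [(p, q)] are split according to whether the letters at [p] and [q]
    agree. If they do, the transposition has no effect on the word. *)
Lemma sum_swap a g :
  (\sum_p \sum_(q | q != p) perm_char a (tperm p q * g)%g =
   (\sum_l a l * (a l).-1) * perm_char a g +
   \sum_i \sum_(j | i != j) quasi_char i j a g)%N.
Proof.
have swapE p q w :
    fixed_word (tperm p q * g)%g w = [forall x, w (g x) == w (tperm p q x)].
  apply/forallP/forallP => H x; have := H (tperm p q x); rewrite permM tpermK //.
rewrite /quasi_char /perm_char; under eq_bigr do rewrite exchange_big /=.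
under [X in (_ + X)%N]eq_bigr do rewrite exchange_big /=.
rewrite exchange_big [X in (_ + X)%N]exchange_big big_distrr -big_split /=.
apply: eq_bigr => w /wordsP aw; rewrite -sum_swap_neq.
under [X in (X * _)%N]eq_bigr do rewrite -aw.
rewrite -sum_swap_eq -big_split; apply: eq_bigr => p _ /=.
rewrite (bigID (fun q => w q == w p)) /=; congr (_ + _)%N.
  by apply: eq_bigr => q _; rewrite swapE.
apply: eq_big => [q|q _]; last by rewrite swapE.
by case: (altP (q =P p)) => // ->; rewrite eqxx.
Qed.

(** The definition of [quasi_fixed] is not symmetric in [i] and [j], but the count of pairs in
    [sum_swap_fixed] is. *)
Lemma quasi_charC g i j a : i != j -> quasi_char i j a g = quasi_char j i a g.
Proof.
move=> ij; apply: eq_bigr => w _; have ji : j != i by rewrite eq_sym.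
rewrite -!sum_swap_fixed // exchange_big.
by apply: eq_bigr => p _; apply: eq_bigr => q _; rewrite tpermC.
Qed.
End PermChar.

(** * The action of transpositions *)

Section CutJoin.
Variables d N : nat.
Implicit Types (a : 'I_N -> nat) (g s : 'S_d) (i j : 'I_N).

Lemma sum_transpositions (F : 'S_d -> nat) :
  (\sum_p \sum_(q | q != p) F (tperm p q)
   = (\sum_(s | is_transposition s) F s).*2)%N.
Proof.
have -> : (\sum_p \sum_(q | q != p) F (tperm p q) =
    (\sum_(p : 'I_d) \sum_(q : 'I_d | (p < q)%N) F (tperm p q)).*2)%N.
  rewrite -addnn [X in _ = (_ + X)%N](exchange_big_dep predT) //= -big_split; apply: eq_bigr => p _ /=.
  rewrite (bigID (fun q : 'I_d => (p < q)%N)) /=; congr (_ + _)%N.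
    by apply: eq_bigl => q; case: ltngtP; rewrite -?(inj_eq val_inj) //=; case: ltngtP.
  apply: eq_big => [q|q _]; last by rewrite tpermC.
  by rewrite -(inj_eq val_inj) /= -leqNgt leq_eqVlt; case: ltngtP.
congr _.*2; rewrite pair_big_dep /=.
pose D := [pred u : 'I_d * 'I_d | (u.1 < u.2)%N].
have injD : {in D &, injective (fun u : 'I_d * 'I_d => tperm u.1 u.2)}.
  case=> p q [p' q']; rewrite !inE /= => pq pq' e.
  have : tperm p' q' p = q by rewrite -e tpermL.
  case: tpermP => [->|pq0|_ _ pq0]; first by move=> ->.
    by move=> qp; move: pq pq'; rewrite pq0 -qp => /ltn_trans h /h; rewrite ltnn.
  by rewrite pq0 ltnn in pq.
rewrite -(@big_imset _ _ _ _ _ (fun u : 'I_d * 'I_d => tperm u.1 u.2) D F) //.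
apply: eq_bigl => s; apply/imsetP/existsP.
  case=> -[p q] /= pq ->; exists p; apply/existsP; exists q.
  by rewrite eqxx andbT -(inj_eq val_inj) ltn_eqF.
case=> p /existsP[q /andP[]]; rewrite -(inj_eq val_inj) neq_ltn => /orP[pq|qp] /eqP ->.
  by exists (p, q).
by exists (q, p); rewrite // tpermC.
Qed.

(** For a Young diagram this is the sum of the contents, column minus row, of its cells: row [i]
    contributes [0 + ... + (a i - 1)] minus [i] for each of its [a i] cells. *)
Definition content_sum a : int := \sum_(i < N) ('C(a i, 2)%:Z - (i * a i)%:Z).

Lemma sum_transp_perm_char a g :
  (\sum_(s : 'S_d | is_transposition s) perm_char a (s * g)%g =
   (\sum_i 'C(a i, 2)) * perm_char a g +
   \sum_(i : 'I_N) \sum_(j : 'I_N | (i < j)%N) quasi_char i j a g)%N.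
Proof.
apply: double_inj; rewrite -sum_transpositions sum_swap doubleD; congr (_ + _)%N.
  rewrite doubleMl; congr (_ * _)%N; rewrite -muln2 big_distrl /=.
  by apply: eq_bigr => i _; rewrite bin2 muln2 even_halfK // oddM; case: (a i) => //= n; rewrite andNb.
rewrite -addnn [X in _ = (_ + X)%N](exchange_big_dep predT) //= -big_split; apply: eq_bigr => i _ /=.
rewrite (bigID (fun j : 'I_N => (i < j)%N)) /=; congr (_ + _)%N.
  by apply: eq_bigl => j; rewrite -(inj_eq val_inj) /=; case: ltngtP.
apply: eq_big => [j|j]; first by rewrite -(inj_eq val_inj) /=; case: ltngtP.
by move=> /andP[ij _]; rewrite quasi_charC.
Qed.

Definition transfer a i j k := shift a i j (a i + a j) k.

(** For [i < j], [quasi_char_shift] at [a j] replaces [quasi_char i j] by transfers minus [a j]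
    times the character of [a]. The [j] values of [i] below [j] give [- j * a j] in all, which
    completes the binomials to [content_sum a]. *)
Lemma transp_perm_char (R : comNzRingType) a g :
  (\sum_(s : 'S_d | is_transposition s) perm_char a (s * g)%g)%:R =
  (content_sum a)%:~R * (perm_char a g)%:R +
  \sum_(i : 'I_N) \sum_(j : 'I_N | (i < j)%N) \sum_(k < a j)
    ((a i + a j)%:R - k%:R *+ 2) * (perm_char (transfer a i j k) g)%:R :> R.
Proof.
rewrite sum_transp_perm_char natrD natrM.
have E i j : (i < j)%N -> \sum_(k < a j)
    ((a i + a j)%:R - k%:R *+ 2) * (perm_char (transfer a i j k) g)%:R =
    (quasi_char i j a g)%:R + (a j)%:R * (perm_char a g)%:R :> R.
  move=> ij; have nij : i != j by rewrite -(inj_eq val_inj) ltn_eqF.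
  have e : shift a i j (a i + a j) (a j) =1 a.
    by move=> l; rewrite /shift addnK; case: eqP => [->|_] //; case: eqP => [->|].
  rewrite -(quasi_char_shift _ _ _ nij) ?leq_addl // (eq_perm_char _ e).
  by rewrite /quasi_char (eq_words _ e).
under [X in _ = _ + X]eq_bigr do under eq_bigr do rewrite E //.
under [X in _ = _ + X]eq_bigr do rewrite big_split /=.
rewrite big_split /= [RHS]addrCA [RHS]addrC !natr_sum; congr (_ + _); last first.
  by apply: eq_bigr => i _; rewrite natr_sum.
under [X in _ = _ + X]eq_bigr do rewrite -mulr_suml.
rewrite -mulr_suml -mulrDl; congr (_ * _).
rewrite (exchange_big_dep predT) //= /content_sum rmorph_sum -big_split; apply: eq_bigr => i _ /=.
rewrite -(big_ord_widen N (fun=> (a i)%:R : R)) ?(ltnW (ltn_ord i)) //.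
rewrite sumr_const card_ord rmorphB /= !pmulrn PoszM rmorphM /= -!pmulrn.
by rewrite mulr_natl subrK.
Qed.

End CutJoin.

(** * Shapes of words *)

Section Shapes.
Variable N : nat.
Implicit Types (a b : 'I_N -> nat).

Lemma sum_transfer (f : nat -> nat) a i j k : i != j ->
  (\sum_x f (transfer a i j k x) + (f (a i) + f (a j)) =
   \sum_x f (a x) + (f (a i + a j - k) + f k))%N.
Proof.
move=> ij; have ji : j != i by rewrite eq_sym.
rewrite (bigD1 i) // (bigD1 j) // [in RHS](bigD1 i) // [in RHS](bigD1 j) //=.
rewrite /transfer /shift !eqxx (negPf ji).
rewrite (eq_bigr (fun x => f (a x))); first by lia.
by move=> x /andP[/negPf -> /negPf ->].
Qed.

Definition sumsq a : nat := (\sum_i a i ^ 2)%N.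

Lemma transfer_sum a i j k : i != j -> (k <= a i + a j)%N ->
  (\sum_x transfer a i j k x = \sum_x a x)%N.
Proof. by move=> ij ks; have := sum_transfer id a k ij; rewrite /=; lia. Qed.

(** For a fixed sum, two parts have a larger sum of squares the further apart they are. The strict
    inequality is what makes the action of [Ksum] triangular. *)
Lemma transfer_sumsq a i j k : i != j -> (k < a j)%N -> (a j <= a i)%N ->
  (sumsq a < sumsq (transfer a i j k))%N.
Proof.
move=> ij kj ji; have := sum_transfer (fun n => n ^ 2)%N a k ij.
rewrite /sumsq; move: (\sum_x _)%N (\sum_x _)%N => X Y e.
suff : (a i ^ 2 + a j ^ 2 < (a i + a j - k) ^ 2 + k ^ 2)%N by lia.
have [m ->] : exists m, a i = (a j + m)%N by exists (a i - a j)%N; lia.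
have [n ->] : exists n, a j = (k + n.+1)%N by exists (a j - k).-1; lia.
have -> : (k + n.+1 + m + (k + n.+1) - k = k + 2 * n.+1 + m)%N by lia.
by rewrite -!mulnn; nia.
Qed.

(** With [S] the total, equality forces [x i ^ 2 = x i * S] for each [i], so each part is [0] or
    [S]. At most one part is then nonzero. *)
Lemma sum_sq_extremal (I : finType) (P : pred I) (x : I -> nat) (f : nat -> nat) :
  f 0%N = 0%N -> (\sum_(i | P i) x i ^ 2 = (\sum_(i | P i) x i) ^ 2)%N ->
  (\sum_(i | P i) f (x i) = f (\sum_(i | P i) x i))%N.
Proof.
set S := (\sum_(i | P i) x i)%N => f0 e.
have xS i : P i -> (x i <= S)%N by move=> Pi; rewrite /S (bigD1 i) //= leq_addr.
have sqS : (S ^ 2 = \sum_(i | P i) x i * S)%N by rewrite -big_distrl /= mulnn.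
have eqx i : P i -> (x i = 0 \/ x i = S)%N.
  have h : (\sum_(i | P i) x i ^ 2 == \sum_(i | P i) x i * S)%N by rewrite e sqS.
  have /leqif_sum H : forall i, P i -> (x i ^ 2 <= x i * S ?= iff (x i ^ 2 == x i * S))%N.
    by move=> k Pk; split=> //; rewrite -mulnn leq_mul2l xS ?orbT.
  move: h; rewrite H => /forall_inP {}H Pi.
  have /eqP := H _ Pi; rewrite -mulnn => /eqP.
  by rewrite eqn_mul2l => /orP[/eqP|/eqP]; [left|right].
have [S0|S0] := posnP S.
  by rewrite S0 f0 big1 // => i Pi; case: (eqx i Pi) => ->; rewrite ?S0.
have [i0 Pi0 xi0] : exists2 i, P i & x i <> 0%N.
  apply: contrapT => H; move: S0; rewrite /S big1 // => i Pi.
  by apply: contrapT => xi; apply: H; exists i.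
have xiS : x i0 = S by case: (eqx _ Pi0).
rewrite (bigD1 i0) //= xiS big1 ?addn0 // => i /andP[Pi ii0].
suff -> : x i = 0%N by [].
have := erefl S; rewrite {1}/S (bigD1 i0) //= (bigD1 i) ?Pi //= xiS; lia.
Qed.

Lemma sum_sq_le (I : finType) (P : pred I) (x : I -> nat) :
  (\sum_(i | P i) x i ^ 2 <= (\sum_(i | P i) x i) ^ 2)%N.
Proof.
rewrite -[in leqRHS]mulnn big_distrl /=; apply: leq_sum => i Pi.
by rewrite -mulnn leq_mul2l (bigD1 i) //= leq_addr orbT.
Qed.

Section Coarsening.
Variables (a b : 'I_N -> nat) (phi : 'I_N -> 'I_N).
Hypothesis bE : forall j, b j = (\sum_(i | phi i == j) a i)%N.

Lemma coarsening_sumsq : (sumsq a <= sumsq b)%N.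
Proof.
rewrite /sumsq (partition_big phi predT) //=; apply: leq_sum => j _.
by rewrite bE sum_sq_le.
Qed.

(** Equality of the total sums of squares forces equality in each fibre of [phi], so no two nonzero
    parts are added together: [a] and [b] have the same nonzero parts. *)
Lemma coarsening_eq (f : nat -> nat) : f 0%N = 0%N -> sumsq a = sumsq b ->
  (\sum_i f (a i) = \sum_j f (b j))%N.
Proof.
move=> f0; rewrite /sumsq (partition_big phi predT) //= => /eqP.
have /leqif_sum H : forall j, true -> (\sum_(i | phi i == j) a i ^ 2 <= b j ^ 2
   ?= iff (\sum_(i | phi i == j) a i ^ 2 == b j ^ 2))%N.
  by move=> j _; split=> //; rewrite bE sum_sq_le.
rewrite H => /forall_inP {}H; rewrite (partition_big phi predT) //=.
apply: eq_bigr => j _; rewrite bE; apply: sum_sq_extremal => //.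
by rewrite -bE; apply/eqP/H.
Qed.
End Coarsening.

(** The rows longer than [k] form an initial segment, whose length is a column length of the
    diagram. Column lengths thus determine a sorted sequence. *)
Lemma nonincreasing_ltn a k (i : 'I_N) :
  (forall i j : 'I_N, (i <= j)%N -> (a j <= a i)%N) ->
  (k < a i)%N = (i < \sum_x (k < a x)%N)%N.
Proof.
move=> H; have [ki|ki] := boolP (k < a i)%N; apply/esym.
  rewrite -[X in (X <= _)%N]card_ord -sum1_card (big_ord_widen N (fun=> 1%N)) //.
  rewrite big_mkcond; apply: leq_sum => x _; case: ifP => // xi.
  by rewrite (leq_trans ki) // H // -ltnS.
apply/negbTE; rewrite -leqNgt -[X in (_ <= X)%N]card_ord -sum1_card.
rewrite (big_ord_widen N (fun=> 1%N)) ?(ltnW (ltn_ord i)) // [leqRHS]big_mkcond.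
apply: leq_sum => x _; case: ifP => [_|]; first by case: leqP.
move=> /negbT; rewrite -leqNgt => /H ix; rewrite (negPf (_ : ~~ (k < a x)%N)) //.
by rewrite -leqNgt (leq_trans ix) // leqNgt.
Qed.

Lemma nonincreasing_eq a b :
  (forall i j : 'I_N, (i <= j)%N -> (a j <= a i)%N) ->
  (forall i j : 'I_N, (i <= j)%N -> (b j <= b i)%N) ->
  (forall k, \sum_x (k < a x)%N = \sum_x (k < b x)%N)%N -> a =1 b.
Proof.
move=> da db e i; apply/eqP; rewrite eqn_leq.
have h k : (k < a i)%N = (k < b i)%N by rewrite !nonincreasing_ltn // e.
by rewrite leqNgt h ltnn /= leqNgt -h ltnn.
Qed.
End Shapes.

(** * Young diagrams and the Casimir eigenvalue *)

Section Young.
Variables d N : nat.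

Lemma youngP (l : {ffun 'I_N -> 'I_d.+1}) :
  reflect ((forall i j : 'I_N, (i <= j)%N -> (l j <= l i)%N) /\
           (\sum_(i < N) l i = d)%N) (l \in young d N).
Proof.
rewrite inE; apply: (iffP andP) => -[h /eqP e]; split=> //.
  by move=> i j; move/forallP: h => /(_ i)/forallP/(_ j)/implyP.
by apply/forallP => i; apply/forallP => j; apply/implyP; apply: h.
Qed.

Lemma young_sort (a : 'I_N -> nat) : (\sum_i a i = d)%N ->
  exists2 l : {ffun 'I_N -> 'I_d.+1}, l \in young d N &
    exists p : 'S_N, forall i, l i = a (p i) :> nat.
Proof.
move=> sa; pose t := [tuple a i | i < N]; pose s := sort_tuple geq t.
have /tuple_permP[p sp] : perm_eq s t by rewrite perm_sort.
have sE i : tnth s i = a (p i) by rewrite (tnth_nth 0%N) sp -tnth_nth !tnth_mktuple.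
have ad i : (a i <= d)%N by rewrite -sa (bigD1 i) //= leq_addr.
exists [ffun i => inord (a (p i))]; last by exists p => i; rewrite ffunE inordK ?ltnS.
apply/youngP; split=> [i j ij|].
  rewrite !ffunE !inordK ?ltnS // -!sE !(tnth_nth 0%N).
  apply: (sorted_leq_nth (leT := geq)) => //; rewrite ?inE ?size_tuple //.
  - by move=> x y z /= yx zx; apply: leq_trans zx yx.
  - by move=> x /=.
  - by apply: sort_sorted => x y; exact: leq_total.
rewrite -[RHS]sa [RHS](reindex_inj (@perm_inj _ p)) /=.
by apply: eq_bigr => i _; rewrite ffunE inordK ?ltnS.
Qed.

(** With rows numbered from [0], the row [i] contributes
    [N * l i + l i * (l i - 1) - 2 * i * l i]. *)
Lemma casimirE (l : {ffun 'I_N -> 'I_d.+1}) : l \in young d N ->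
  casimir l = (N * d)%:Z + 2 * content_sum (fun i => l i).
Proof.
move=> /youngP[_ sl]; have -> : (N * d = \sum_(i < N) N * l i)%N by rewrite -big_distrr /= sl.
rewrite /content_sum mulr_sumr (big_morph Posz PoszD erefl) -big_split /=.
apply: eq_bigr => i _; rewrite mulrBr.
have /(congr1 Posz) : ('C(l i, 2) * 2 = l i * (l i).-1)%N.
  by rewrite bin2 muln2 even_halfK // oddM; case: (nat_of_ord (l i)) => //= n; rewrite andNb.
case: (nat_of_ord (l i)) => [|n] /=; first by lia.
rewrite !PoszM; lia.
Qed.
End Young.

(** * Cycle types *)

Section CyclicWords.
Variables d N : nat.
Implicit Types (g h : 'S_d) (w v : {ffun 'I_d -> 'I_N}) (l : 'I_N).

(* The cycles of [g] are the nonempty level sets of [w]. *)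
Definition cyclic_on g w : Prop := forall x y, (y \in porbit g x) = (w x == w y).

Lemma cyclic_on_fixed g w : cyclic_on g w -> forall x, w (g x) = w x.
Proof. by move=> H x; apply/eqP; rewrite eq_sym -H -[g x]/((g ^+ 1)%g x) mem_porbit. Qed.

Lemma cyclic_on_card g w x : cyclic_on g w -> #|porbit g x| = wcontent w (w x).
Proof. by move=> H; apply: eq_card => y; rewrite H inE eq_sym. Qed.

Lemma fixed_word_iter g w n x : (forall x, w (g x) = w x) -> w (iter n g x) = w x.
Proof. by move=> H; elim: n => //= n <-. Qed.

Lemma iter_porbit_mod g n x : iter (n %% #|porbit g x|) g x = iter n g x.
Proof.
rewrite [in RHS](divn_eq n #|porbit g x|) addnC iterD; congr iter.
by elim: (n %/ _)%N => //= m IHm; rewrite mulSn iterD -IHm iter_porbit.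
Qed.

Lemma iter_porbit_inj g x n m : (n < #|porbit g x|)%N -> (m < #|porbit g x|)%N ->
  iter n g x = iter m g x -> n = m.
Proof.
move=> nc mc e; apply/eqP.
by rewrite -(nth_uniq x _ _ (uniq_traject_porbit g x)) ?size_traject // !nth_traject // e.
Qed.

(** Cycles of [g] and [g'] labelled by the same letter have the same length. Once a base point is
    chosen in each, sending the [n]-th iterate of [g] at one to the [n]-th iterate of [g'] at the
    other conjugates [g] into [g']. *)
Lemma cyclic_on_conj g g' w w' : cyclic_on g w -> cyclic_on g' w' ->
  wcontent w =1 wcontent w' -> exists h, g' = (g ^ h)%g.
Proof.
move=> Hg Hg' ww'.
(* The default is never reached, so both base points depend only on the letter [w x]. *)
pose base x := odflt x [pick y | w y == w x].
pose base' x := odflt x [pick y | w' y == w x].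
have wbase x : w (base x) = w x.
  by rewrite /base; case: pickP => [y /eqP|/(_ x)]; rewrite ?eqxx.
have wbase' x : w' (base' x) = w x.
  rewrite /base'; case: pickP => [y /eqP //|none].
  have : (0 < wcontent w' (w x))%N.
    by rewrite -ww'; apply/card_gt0P; exists x; rewrite inE.
  by case/card_gt0P => y; rewrite inE none.
have base_eq x y : w x = w y -> base x = base y.
  move=> e; rewrite /base e; case: pickP => // /(_ y); by rewrite eqxx.
have base_eq' x y : w x = w y -> base' x = base' y.
  move=> e; rewrite /base' e; case: pickP => // none.
  have : (0 < wcontent w' (w y))%N.
    by rewrite -ww'; apply/card_gt0P; exists y; rewrite inE.
  by case/card_gt0P => z; rewrite inE none.
have card_eq x : #|porbit g (base x)| = #|porbit g' (base' x)|.
  by rewrite (cyclic_on_card _ Hg) (cyclic_on_card _ Hg') ww' wbase wbase'.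
pose idx x := index x (traject g (base x) #|porbit g (base x)|).
have xin x : x \in traject g (base x) #|porbit g (base x)|.
  by rewrite -porbit_traject Hg wbase.
have idx_lt x : (idx x < #|porbit g (base x)|)%N.
  by rewrite -[X in (_ < X)%N](size_traject g (base x)) index_mem.
have idxK x : iter (idx x) g (base x) = x.
  by rewrite -(nth_traject _ (idx_lt x)) nth_index.
pose f x := iter (idx x) g' (base' x).
have wf x : w' (f x) = w x.
  by rewrite /f fixed_word_iter ?wbase' //; apply: cyclic_on_fixed.
have f_inj : injective f.
  move=> x y e; have wxy : w x = w y by rewrite -!wf e.
  have bxy := base_eq _ _ wxy; have bxy' := base_eq' _ _ wxy.
  move: e; rewrite /f -bxy' => /iter_porbit_inj e.
  by rewrite -[x]idxK -[y]idxK -bxy e // -card_eq // bxy.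
have fE x n : f (iter n g x) = iter n g' (f x).
  have wn : w (iter n g x) = w x by apply/fixed_word_iter/cyclic_on_fixed.
  have bn := base_eq _ _ wn; have bn' := base_eq' _ _ wn.
  rewrite /f -iterD bn' -iter_porbit_mod -[RHS]iter_porbit_mod -card_eq.
  congr iter; rewrite modn_small; last by rewrite -bn idx_lt.
  apply: (@iter_porbit_inj g (base x)).
  - by rewrite -[X in porbit g X]bn idx_lt.
  - by rewrite ltn_mod (leq_ltn_trans _ (idx_lt x)).
  by rewrite iter_porbit_mod iterD idxK -[X in iter _ _ X]bn idxK.
exists (perm f_inj); apply/permP => y.
pose x := ((perm f_inj)^-1)%g y; have -> : y = perm f_inj x by rewrite permKV.
by rewrite permJ !permE; exact: esym (fE x 1%N).
Qed.

(** Each level set is enumerated, and every point is sent to the next one in cyclic order. *)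
Lemma cyclic_on_exists w : exists g, cyclic_on g w.
Proof.
pose fib x := enum [set y | w y == w x].
have fibP x y : (y \in fib x) = (w y == w x) by rewrite mem_enum inE.
have fib_eq x y : w x = w y -> fib x = fib y by rewrite /fib => ->.
pose f x := next (fib x) x.
have wf x : w (f x) = w x.
  by apply/eqP; rewrite -fibP mem_next fibP.
have f_inj : injective f.
  move=> x y e; have wxy : w x = w y by rewrite -(wf x) e wf.
  move: e; rewrite /f -(fib_eq _ _ wxy) => /(congr1 (prev (fib x))).
  by rewrite !prev_next // enum_uniq.
exists (perm f_inj) => x y; apply/porbitP/eqP.
  case=> n ->; rewrite permX fixed_word_iter // => u.
  by rewrite permE wf.
move=> wxy; have : fconnect f x y.
  rewrite (@fconnect_cycle _ _ (fib x)) ?fibP ?wxy //.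
  have -> : fcycle f (fib x) = fcycle (next (fib x)) (fib x).
    apply: (eq_in_cycle (P := [in fib x])); last exact/allP.
    move=> u v; rewrite [u \in _]fibP => /eqP wu _ /=.
    by rewrite /f (fib_eq _ _ wu).
  exact: cycle_next (enum_uniq _).
move=> /iter_findex <-; exists (findex f x y); rewrite permX.
by apply: eq_iter => u; rewrite permE.
Qed.

(** A point is labelled by a representative of its cycle, which is a letter because [d <= N]. *)
Lemma cyclic_word_exists g : (d <= N)%N -> exists w, cyclic_on g w.
Proof.
move=> dN; pose r x := odflt x [pick y in porbit g x].
have rx x : r x \in porbit g x.
  by rewrite /r; case: pickP => //= _; exact: porbit_id.
exists [ffun x => widen_ord dN (r x)] => x y; rewrite !ffunE.
have -> : (widen_ord dN (r x) == widen_ord dN (r y)) = (r x == r y) by [].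
apply/idP/eqP.
  rewrite -eq_porbit_mem => /eqP e; rewrite /r e.
  by case: pickP => //= /(_ x); rewrite porbit_id.
move=> e; rewrite -eq_porbit_mem; have := rx x; have := rx y.
by rewrite e -!eq_porbit_mem => /eqP -> /eqP ->.
Qed.

Lemma sum_wcontent w (P : pred 'I_N) :
  (\sum_(l | P l) wcontent w l = \sum_x P (w x))%N.
Proof.
under eq_bigr do rewrite wcontentE.
rewrite exchange_big /=; apply: eq_bigr => x _.
case: (boolP (P (w x))) => Px; last by rewrite big1 // => l Pl; case: eqP Px => // ->; rewrite Pl.
by rewrite (bigD1 (w x)) //= eqxx big1 // => l /andP[_]; rewrite eq_sym => /negPf ->.
Qed.

Lemma sum_wcontentT w : (\sum_l wcontent w l = d)%N.
Proof. by rewrite (sum_wcontent w predT) sum_nat_const card_ord muln1. Qed.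

Lemma word_exists (a : 'I_N -> nat) : (\sum_l a l = d)%N ->
  exists w, wcontent w =1 a.
Proof.
move=> sa; pose s := flatten [seq nseq (a l) l | l <- enum 'I_N].
have countE l : count_mem l s = a l.
  rewrite count_flatten -map_comp sumnE big_map big_enum /=.
  rewrite (bigD1 l) //= count_nseq /= eqxx mul1n big1 ?addn0 // => k kl.
  by rewrite count_nseq /= (negPf kl).
have sz : size s = d.
  rewrite size_flatten /shape -map_comp sumnE big_map big_enum /= -sa.
  by apply: eq_bigr => l _; rewrite size_nseq.
(* Reading [s] with [nth] needs a default letter, which exists when [d] is positive; for [d = 0] the
   word is empty. *)
have [d0|d_gt0] := posnP d.
  have noI : 'I_d -> False by rewrite d0; case.
  exists [ffun x => False_rect _ (noI x)] => l.
  rewrite wcontentE big1; last by move=> x; case: (noI x).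
  by move: sa; rewrite d0 (bigD1 l) //=; lia.
have l0 : 'I_N by move: sa d_gt0; case: (N) a {s countE sz} => [a|n]; rewrite ?big_ord0 => *; [lia|exact: ord0].
exists [ffun x : 'I_d => nth l0 s x] => l; rewrite wcontentE -countE -sum1_count.
rewrite (big_nth l0) sz big_mkord [RHS]big_mkcond /=.
by apply: eq_bigr => x _; rewrite ffunE; case: eqP.
Qed.

Lemma cyclic_word_young g : (d <= N)%N ->
  exists2 l : {ffun 'I_N -> 'I_d.+1}, l \in young d N &
    exists2 w, cyclic_on g w & wcontent w =1 (fun i => l i).
Proof.
move=> dN; have [w Hw] := cyclic_word_exists g dN.
have [l lY [p lp]] := young_sort (sum_wcontentT w).
exists l => //; exists [ffun x => (p^-1)%g (w x)].
  by move=> x y; rewrite Hw !ffunE (inj_eq (@perm_inj _ _)).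
move=> i; rewrite lp !wcontentE; apply: eq_bigr => x _.
by rewrite ffunE -(inj_eq (@perm_inj _ p)) permKV.
Qed.

Lemma perm_char_cyclic g w : cyclic_on g w -> (0 < perm_char (wcontent w) g)%N.
Proof.
move=> /cyclic_on_fixed /fixed_wordP H; rewrite /perm_char (bigD1 w) ?H //.
exact/wordsP.
Qed.

(** A word fixed by [g] is constant on the cycles of [g], hence factors through [w]; [phi] is the
    induced map of letters. *)
Lemma perm_char_neq0 g w (b : 'I_N -> nat) : cyclic_on g w ->
  perm_char b g <> 0%N -> exists phi : 'I_N -> 'I_N,
    forall j, b j = (\sum_(i | phi i == j) wcontent w i)%N.
Proof.
move=> Hw nz; have [v /wordsP vb /fixed_wordP Hv] :
    exists2 v, v \in words 'I_d b & fixed_word g v.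
  apply: contrapT => none; apply: nz; rewrite /perm_char big1 // => v vb.
  by case: (boolP (fixed_word g v)) => // Hv; case: none; exists v.
have vw x y : w x = w y -> v x = v y.
  move/eqP; rewrite -Hw => /porbitP[n ->].
  by rewrite permX fixed_word_iter.
(* Letters absent from [w] are sent to themselves and add content [0]. *)
exists (fun i => if [pick x | w x == i] is Some x then v x else i) => j.
rewrite -vb (sum_wcontent w) wcontentE; apply: eq_bigr => x _.
case: pickP => [y /eqP /vw -> //|/(_ x)]; by rewrite eqxx.
Qed.
End CyclicWords.

(** By [perm_char_neq0], [m] is a coarsening of [l]. If the sums of squares agree, both have the
    same nonzero parts, and being sorted they are equal. *)
Lemma perm_char_triangular d N (g : 'S_d) (w : {ffun 'I_d -> 'I_N})
    (l m : {ffun 'I_N -> 'I_d.+1}) :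
  l \in young d N -> m \in young d N -> cyclic_on g w ->
  wcontent w =1 (fun i => l i) -> perm_char (fun i => m i : nat) g <> 0%N ->
  m = l \/ (sumsq (fun i => l i) < sumsq (fun i => m i))%N.
Proof.
move=> /youngP[dl _] /youngP[dm _] Hw wl /(perm_char_neq0 Hw)[phi mE].
have {}mE j : m j = (\sum_(i | phi i == j) l i)%N :> nat.
  by rewrite mE; apply: eq_bigr => i _; rewrite wl.
have := coarsening_sumsq mE; rewrite leq_eqVlt => /orP[/eqP e|]; last by right.
left; apply/ffunP => i; apply/val_inj/esym.
apply: (@nonincreasing_eq N (fun i => l i) (fun i => m i)) => // k.
exact: (coarsening_eq mE (f := fun n => (k < n)%N)).
Qed.

(** * The trace formula *)

Section Triangular.
Variables (F : fieldType) (n : nat) (f : 'I_n -> nat).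

(* Strictness in [f] makes the diagonal multiplicative although [f] need not be
   injective. *)
Definition triangular_for (A : 'M[F]_n) : Prop :=
  forall i j, i != j -> A i j != 0 -> (f i < f j)%N.

(** Along nonzero off-diagonal entries [f] increases strictly, so no product through [k != i]
    returns to [i]. *)
Lemma triangular_forM A B : triangular_for A -> triangular_for B ->
  triangular_for (A *m B) /\ forall i, (A *m B) i i = A i i * B i i.
Proof.
move=> hA hB; split=> [i j ij|i].
   rewrite mxE => /eqP nz.
  have [k] : exists k, A i k * B k j != 0.
    apply: contrapT => H; apply: nz; apply: big1 => k _; apply/eqP.
    by apply: contrapT => /negP h; apply: H; exists k.
  rewrite mulf_eq0 negb_or => /andP[Aik Bkj].
  have [e|ik] := eqVneq i k; first by apply: hB => //; rewrite e.
  have [e|kj] := eqVneq k j; first by rewrite -e hA.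
  exact: ltn_trans (hA _ _ ik Aik) (hB _ _ kj Bkj).
rewrite mxE (bigD1 i) //= big1 ?addr0 // => k ki; apply/eqP.
rewrite mulf_eq0; apply: contraT; rewrite negb_or => /andP[Aik Bki].
have := hA _ _ _ Aik; rewrite eq_sym ki => /(_ isT) h1.
by have := ltn_trans h1 (hB _ _ ki Bki); rewrite ltnn.
Qed.

Lemma mxtrace_triangularX (A : 'M[F]_n) r : triangular_for A ->
  \tr (A ^+ r) = \sum_i A i i ^+ r.
Proof.
move=> hA; suff [_ h] : triangular_for (A ^+ r) /\ forall i, (A ^+ r) i i = A i i ^+ r.
  by apply: eq_bigr => i _; rewrite h.
elim: r => [|r [hr dr]].
  split=> [i j ij|i]; first by rewrite expr0 mxE (negPf ij) eqxx.
  by rewrite !expr0 mxE eqxx.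
have [h1 h2] := triangular_forM hA hr; rewrite exprS; split=> // i.
by rewrite h2 dr -exprS.
Qed.
End Triangular.

(** * The commutator sum as a trace in the regular representation *)

Section Regular.
Variables (R : realType) (d : nat).
Local Notation C := (Cplx R).
Local Notation n := #|Sgrp d|.
Implicit Types (s g : 'S_d).

Definition perm_rank g : 'I_n := gring_index (Sgrp d) g.
Definition perm_val (i : 'I_n) : 'S_d := enum_val i.

Lemma perm_rankK : cancel perm_rank perm_val. Proof. by move=> g; apply: gring_indexK; rewrite inE. Qed.
Lemma perm_valK : cancel perm_val perm_rank. Proof. exact: gring_valK. Qed.

Lemma eq_perm_rank i g : (i == perm_rank g) = (perm_val i == g).
Proof. by rewrite -(inj_eq (can_inj perm_valK)) perm_rankK. Qed.

Lemma geltE s i j : gelt R s i j = (perm_val j == perm_val i * s)%g%:R.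
Proof. by rewrite /gelt /= mxE mxE eqxx -eq_perm_rank. Qed.

Lemma mulmx_gelt m (M : 'M[C]_(m, n)) s i j :
  (M *m gelt R s) i j = M i (perm_rank (perm_val j * s^-1)%g).
Proof.
rewrite mxE (bigD1 (perm_rank (perm_val j * s^-1)%g)) //= geltE perm_rankK mulgKV eqxx mulr1.
rewrite big1 ?addr0 // => k; rewrite eq_perm_rank geltE => kj.
by case: eqP => [e|]; rewrite ?mulr0 //; rewrite e mulgK eqxx in kj.
Qed.

Lemma gelt_mulmx m (M : 'M[C]_(n, m)) s i j :
  (gelt R s *m M) i j = M (perm_rank (perm_val i * s)%g) j.
Proof.
rewrite mxE (bigD1 (perm_rank (perm_val i * s)%g)) //= geltE perm_rankK eqxx mul1r.
rewrite big1 ?addr0 // => k; rewrite eq_perm_rank geltE => /negPf ->.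
by rewrite mul0r.
Qed.

Lemma idcoefE (A : 'M[C]_n) : idcoef A = A (perm_rank 1%g) (perm_rank 1%g).
Proof. by rewrite /idcoef /gring_proj /gring_row /= !mxE. Qed.

Lemma idcoef_sum (I : finType) (P : pred I) (A : I -> 'M[C]_n) :
  idcoef (\sum_(k | P k) A k) = \sum_(k | P k) idcoef (A k).
Proof. by rewrite idcoefE summxE; under [RHS]eq_bigr do rewrite idcoefE. Qed.

Lemma is_transpositionJ s g : is_transposition (s ^ g)%g = is_transposition s.
Proof.
have trJ (t h : 'S_d) : is_transposition t -> is_transposition (t ^ h)%g.
  move=> /existsP[a /existsP[b /andP[ab /eqP ->]]].
  apply/existsP; exists (h a); apply/existsP; exists (h b).
  by rewrite tpermJ eqxx (inj_eq perm_inj) ab.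
by apply/idP/idP; last exact: trJ; move=> /(trJ _ (g^-1)%g); rewrite conjgK.
Qed.

Lemma is_transpositionV s : is_transposition s -> (s^-1)%g = s.
Proof. by move=> /existsP[a /existsP[b /andP[_ /eqP ->]]]; rewrite tpermV. Qed.

Lemma Ksum_comm g : Ksum R d *m gelt R g = gelt R g *m Ksum R d.
Proof.
rewrite /Ksum mulmx_suml mulmx_sumr (reindex_inj (conjg_inj (g^-1)%g)) /=.
apply: eq_big => s; first by rewrite is_transpositionJ.
by rewrite -!geltM conjgE invgK -!mulgA mulVg mulg1.
Qed.

Lemma KsumX_comm r g : Ksum R d ^+ r *m gelt R g = gelt R g *m Ksum R d ^+ r.
Proof.
elim: r => [|r IH]; first by rewrite expr0 mulmx1 mul1mx.
by rewrite exprSr -!mulmxE -mulmxA Ksum_comm mulmxA IH mulmxA.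
Qed.

(* [d!] times the projector onto class functions. *)
Definition conj_mx : 'M[C]_n :=
  \matrix_(i, j) \sum_(rho : 'S_d) (perm_val j == perm_val i ^ rho)%g%:R.

(** After [sigma] is replaced by its inverse, centrality of [Ksum R d ^+ r] lets the last factor
    move to its right. The identity coefficient becomes the entry at [(sigma ^ rho, sigma)], and
    summing over [rho] gives [conj_mx]. *)
Lemma idcoef_HK r :
  idcoef (Hsum R d *m Ksum R d ^+ r) = \tr (conj_mx *m Ksum R d ^+ r).
Proof.
transitivity (\sum_(rho : 'S_d) \sum_(sigma : 'S_d)
    (Ksum R d ^+ r) (perm_rank (sigma ^ rho)%g) (perm_rank sigma)).
  rewrite /Hsum mulmx_suml idcoef_sum; apply: eq_bigr => rho _.
  rewrite mulmx_suml idcoef_sum (reindex_inj invg_inj); apply: eq_bigr => s _.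
  rewrite invgK geltM -mulmxA -KsumX_comm mulmxA idcoefE mulmx_gelt gelt_mulmx.
  by rewrite invgK perm_rankK !mul1g conjgE mulgA.
rewrite /mxtrace; under [RHS]eq_bigr do rewrite mxE.
rewrite exchange_big (reindex perm_val) /=; last exact: onW_bij (Bijective perm_valK perm_rankK).
apply: eq_bigr => i _; rewrite perm_valK.
under [RHS]eq_bigr do rewrite mxE mulr_suml.
rewrite exchange_big; apply: eq_bigr => rho _ /=.
rewrite (bigD1 (perm_rank (perm_val i ^ rho)%g)) //= perm_rankK eqxx mul1r big1 ?addr0 // => j.
by rewrite eq_perm_rank => /negPf ->; rewrite mul0r.
Qed.
End Regular.

(** * The basis of permutation characters and the trace of powers of [Ksum] *)

Section CharacterTable.
Variables (R : realType) (d N : nat).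
Hypothesis dN : (d <= N)%N.
Local Notation C := (Cplx R).
Local Notation n := #|Sgrp d|.
Local Notation m := #|young d N|.

Definition row_lengths (b : 'I_m) : 'I_N -> nat := fun i => enum_val b i.

Lemma row_lengths_young (b : 'I_m) : enum_val b \in young d N. Proof. exact: enum_valP. Qed.

Lemma sum_row_lengths b : (\sum_i row_lengths b i = d)%N.
Proof. by have /youngP[] := row_lengths_young b. Qed.

Lemma row_lengths_nonincreasing b (i j : 'I_N) : (i <= j)%N -> (row_lengths b j <= row_lengths b i)%N.
Proof. by have /youngP[h _] := row_lengths_young b; apply: h. Qed.

Definition char_mx : 'M[C]_(m, n) := \matrix_(b, j) (perm_char (row_lengths b) (perm_val j))%:R.

Lemma char_mx_conj : char_mx *m conj_mx R d = d`!%:R *: char_mx.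
Proof.
apply/matrixP => b j; rewrite !mxE.
under eq_bigr do rewrite !mxE mulr_sumr.
rewrite exchange_big -[in RHS]card_Sn mulr_natl -sumr_const; apply: eq_bigr => rho _.
rewrite (bigD1 (perm_rank (perm_val j ^ rho^-1)%g)) //= perm_rankK conjgKV eqxx mulr1 perm_char_conj.
rewrite big1 ?addr0 // => i; rewrite eq_perm_rank => ij.
by case: eqP => [e|]; rewrite ?mulr0 //; rewrite e conjgK eqxx in ij.
Qed.

Lemma char_mx_KsumE b x : (char_mx *m Ksum R d) b x =
  (\sum_(s : 'S_d | is_transposition s) perm_char (row_lengths b) (s * perm_val x)%g)%:R.
Proof.
rewrite /Ksum mulmx_sumr summxE natr_sum; apply: eq_bigr => s sT.
rewrite mulmx_gelt mxE perm_rankK is_transpositionV //; congr _%:R.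
(* Conjugation moves [s] from the right of [perm_val x] to its left. *)
rewrite -(perm_char_conj _ _ (s^-1)%g) conjgE invgK; congr perm_char.
by rewrite -!mulgA mulgV mulg1.
Qed.

Lemma row_lengths_sort (a : 'I_N -> nat) : (\sum_i a i = d)%N ->
  exists2 b : 'I_m, (forall g : 'S_d, perm_char a g = perm_char (row_lengths b) g) &
    sumsq a = sumsq (row_lengths b).
Proof.
move=> /young_sort[l lY [p lp]]; exists (enum_rank_in lY l).
  move=> g; rewrite -(perm_char_letters a g p); apply: eq_perm_char => i.
  by rewrite /row_lengths enum_rankK_in //= lp.
rewrite /sumsq (reindex_inj (@perm_inj _ p)); apply: eq_bigr => i _.
by rewrite /row_lengths enum_rankK_in //= lp.
Qed.

Definition in_upper (k : nat) (v : 'rV[C]_n) : Prop :=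
  exists2 r : 'rV[C]_m, v = r *m char_mx &
    forall b, r 0 b != 0 -> (k < sumsq (row_lengths b))%N.

Lemma in_upper0 k : in_upper k 0.
Proof. by exists 0; [rewrite mul0mx | move=> b; rewrite mxE eqxx]. Qed.

Lemma in_upperD k u v : in_upper k u -> in_upper k v -> in_upper k (u + v).
Proof.
move=> [r -> hr] [s -> hs]; exists (r + s); first by rewrite mulmxDl.
move=> b; rewrite mxE; have [->|rb _] := eqVneq (r 0 b) 0; last exact: hr.
by rewrite add0r; apply: hs.
Qed.

Lemma in_upper_char k (a : 'I_N -> nat) (c : C) : (\sum_i a i = d)%N ->
  (k < sumsq a)%N -> in_upper k (\row_j (c * (perm_char a (perm_val j))%:R)).
Proof.
move=> /row_lengths_sort[b pb ->] kb; exists (c *: delta_mx 0 b).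
  by apply/rowP => j; rewrite -scalemxAl -rowE !mxE pb.
move=> b'; rewrite !mxE eqxx /=; case: (eqVneq b' b) => [-> //|_].
by rewrite mulr0 eqxx.
Qed.

(** Row lengths decrease, so in [transp_perm_char] every transfer with [i < j] goes from a row to
    one at least as long and raises the sum of squares. *)
Lemma char_mx_Ksum_row b :
  in_upper (sumsq (row_lengths b))
    (row b (char_mx *m Ksum R d) - (content_sum (row_lengths b))%:~R *: row b char_mx).
Proof.
have -> : row b (char_mx *m Ksum R d) - (content_sum (row_lengths b))%:~R *: row b char_mx =
    \sum_(i : 'I_N) \sum_(j : 'I_N | (i < j)%N) \sum_(k < row_lengths b j) \row_x
      (((row_lengths b i + row_lengths b j)%:R - k%:R *+ 2) *
       (perm_char (transfer (row_lengths b) i j k) (perm_val x))%:R).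
  apply/rowP => x; rewrite [RHS]summxE.
  rewrite mxE [row b _ 0 x]mxE char_mx_KsumE transp_perm_char !mxE addrAC subrr add0r.
  apply: eq_bigr => i _; rewrite summxE; apply: eq_bigr => j _.
  by rewrite summxE; apply: eq_bigr => k _; rewrite mxE.
apply: big_ind; [exact: in_upper0 | exact: in_upperD |] => i _.
apply: big_ind; [exact: in_upper0 | exact: in_upperD |] => j ij.
have nij : i != j by rewrite -(inj_eq val_inj) ltn_eqF.
have ji := @row_lengths_nonincreasing b i j (ltnW ij).
apply: big_ind; [exact: in_upper0 | exact: in_upperD |] => k _.
apply: in_upper_char; last exact: transfer_sumsq.
rewrite transfer_sum ?sum_row_lengths //.
by rewrite (leq_trans (ltnW (ltn_ord k))) // leq_addl.
Qed.

Lemma char_mx_Ksum : exists2 A : 'M[C]_m, char_mx *m Ksum R d = A *m char_mx &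
  triangular_for (fun b => sumsq (row_lengths b)) A /\
  forall b, A b b = (content_sum (row_lengths b))%:~R.
Proof.
have /choice[r hr] : forall b, exists r : 'rV[C]_m,
    row b (char_mx *m Ksum R d) = (content_sum (row_lengths b))%:~R *: row b char_mx
      + r *m char_mx /\
    forall b', r 0 b' != 0 -> (sumsq (row_lengths b) < sumsq (row_lengths b'))%N.
  move=> b; have [r e h] := char_mx_Ksum_row b; exists r; split=> //.
  by rewrite -e addrC subrK.
exists (\matrix_(b, b') ((content_sum (row_lengths b))%:~R *+ (b' == b) + r b 0 b')).
  apply/row_matrixP => b; rewrite (hr b).1 row_mul.
  have -> : row b (\matrix_(b, b') ((content_sum (row_lengths b))%:~R *+ (b' == b) + r b 0 b')) =
      (content_sum (row_lengths b))%:~R *: delta_mx 0 b + r b.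
    by apply/rowP => b'; rewrite !mxE eqxx /= mulr_natr.
  by rewrite mulmxDl -scalemxAl -rowE.
split=> [b b' bb'|b]; rewrite mxE.
  by rewrite [b' == b]eq_sym (negPf bb') mulr0n add0r => /(hr b).2.
rewrite eqxx; have [->|/(hr b).2] := eqVneq (r b 0 b) 0; first by rewrite addr0.
by rewrite ltnn.
Qed.

Lemma row_lengths_cyclic b : exists g : 'S_d, exists2 w : {ffun 'I_d -> 'I_N},
  cyclic_on g w & wcontent w =1 row_lengths b.
Proof.
have [w hw] := word_exists (sum_row_lengths b).
by have [g hg] := cyclic_on_exists w; exists g, w.
Qed.

(** In a vanishing combination, take a nonzero coefficient [b] with the largest sum of squares and
    evaluate at a permutation of cycle type [b]. By [perm_char_triangular] only the term of [b]
    survives, and its character value is positive. *)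
Lemma char_mx_free : row_free char_mx.
Proof.
apply: inj_row_free => v v0; apply/eqP/contraT => /matrix0Pn[i [b0]].
rewrite ord1 => {i} vb0.
case: (@arg_maxnP _ b0 (fun b => v 0 b != 0) (fun b => sumsq (row_lengths b)) vb0) => b vb bmax.
have [g [w hg hw]] := row_lengths_cyclic b.
have : (v *m char_mx) 0 (perm_rank g) = v 0 b * (perm_char (row_lengths b) g)%:R.
  rewrite mxE (bigD1 b) //= mxE perm_rankK big1 ?addr0 // => b' b'b.
  rewrite mxE perm_rankK; apply/eqP; rewrite mulf_eq0; apply: contraT.
  rewrite negb_or => /andP[vb']; rewrite pnatr_eq0 => /eqP nz.
  have [/enum_val_inj e|] := perm_char_triangular (row_lengths_young b) (row_lengths_young b') hg hw nz.
    by rewrite e eqxx in b'b.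
  by move=> lt; have /= := bmax _ vb'; rewrite leqNgt lt.
rewrite v0 mxE => /esym/eqP; rewrite mulf_eq0 (negPf vb) pnatr_eq0 /=.
by have := perm_char_cyclic hg; rewrite (eq_perm_char _ hw) lt0n => /negPf ->.
Qed.

(** Conjugate permutations give equal rows. As [d <= N], every permutation is conjugate to one
    chosen for a Young diagram. *)
Lemma rank_conj_mx : (\rank (conj_mx R d) <= m)%N.
Proof.
have /choice[g hg] : forall b, exists g : 'S_d, exists2 w : {ffun 'I_d -> 'I_N},
  cyclic_on g w & wcontent w =1 row_lengths b by exact: row_lengths_cyclic.
apply: leq_trans (mxrankS _) (rank_leq_row (rowsub (fun b => perm_rank (g b)) (conj_mx R d))).
apply/row_subP => i.
have [l lY [w hw wl]] := cyclic_word_young (perm_val i) dN.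
pose b := enum_rank_in lY l; have [w' hw' wl'] := hg b.
have [|h hE] := cyclic_on_conj hw' hw.
  by move=> k; rewrite wl' wl /row_lengths enum_rankK_in.
have -> : row i (conj_mx R d) = row b (rowsub (fun b => perm_rank (g b)) (conj_mx R d)).
  apply/rowP => j; rewrite !mxE perm_rankK hE [RHS](reindex_inj (mulgI h)) /=.
  by apply: eq_bigr => rho _; rewrite conjgM.
exact: row_sub.
Qed.

(** By the rank bound, [char_mx] and [conj_mx] have the same row space. Writing [conj_mx] as
    [S *m char_mx] gives [char_mx *m S = d!], and cycling the trace replaces [Ksum] by its
    triangular matrix [A]. *)
Lemma idcoef_HK_young r : idcoef (Hsum R d *m Ksum R d ^+ r) =
  d`!%:R * \sum_(b < m) (content_sum (row_lengths b))%:~R ^+ r.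
Proof.
rewrite idcoef_HK.
have dn0 : d`!%:R != 0 :> C by rewrite pnatr_eq0 -lt0n fact_gt0.
have EP : (char_mx <= conj_mx R d)%MS.
  by apply/submxP; exists (d`!%:R^-1 *: char_mx); rewrite -scalemxAl char_mx_conj scalerA mulVf ?scale1r.
have /submxP[S PS] : (conj_mx R d <= char_mx)%MS.
  rewrite -(geq_leqif (mxrank_leqif_sup EP)).
  by move: char_mx_free; rewrite /row_free => /eqP ->; exact: rank_conj_mx.
have ES : char_mx *m S = d`!%:R%:M.
  apply: (row_free_inj char_mx_free).
  by rewrite -mulmxA -PS char_mx_conj mul_scalar_mx.
have [A EK [tA dA]] := char_mx_Ksum.
have EKr : char_mx *m Ksum R d ^+ r = A ^+ r *m char_mx.
  elim: (r) => [|k IH]; first by rewrite !expr0 mulmx1 mul1mx.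
  by rewrite !exprS -!mulmxE mulmxA EK -!mulmxA IH.
rewrite PS -mulmxA EKr mxtrace_mulC -mulmxA ES mul_mx_scalar mxtraceZ.
by rewrite (mxtrace_triangularX r tA); under eq_bigr do rewrite dA.
Qed.
End CharacterTable.

(** * Hurwitz numbers and the exponential series *)

Section Hurwitz.
Variables (R : realType) (d : nat).

Lemma KsumX r : Ksum R d ^+ r =
  \sum_(tau : r.-tuple 'S_d | all (@is_transposition d) tau)
    gelt R (\prod_(i < r) tnth tau i)%g.
Proof.
elim: r => [|r IH].
  rewrite expr0 (bigD1 [tuple]) //= big_ord0 big1 ?addr0; first by rewrite /gelt repr_mx1.
  by move=> tau; rewrite tuple0 andbC.
rewrite exprS IH -mulmxE {1}/Ksum mulmx_suml.
under eq_bigr do rewrite mulmx_sumr.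
rewrite pair_big /=.
rewrite (reindex (fun tau : r.+1.-tuple 'S_d => (thead tau, [tuple of behead tau]))) /=.
  apply: eq_big => [tau|tau _]; first by rewrite [in RHS](tuple_eta tau).
  rewrite -geltM big_ord_recl; congr (gelt R (_ * _)%g).
  by apply: eq_bigr => i _; rewrite [in RHS](tuple_eta tau) tnthS.
exists (fun u : 'S_d * r.-tuple 'S_d => [tuple of u.1 :: u.2]) => [tau _|[s tau] _] /=.
  by rewrite -tuple_eta.
by rewrite theadE; congr (_, _); apply: val_inj.
Qed.

Lemma idcoef_HK_hurwitz r :
  idcoef (Hsum R d *m Ksum R d ^+ r) = (simple_hurwitz d r)%:R.
Proof.
transitivity (\sum_rho \sum_sigma \sum_(tau : r.-tuple 'S_d)
    ((rho, sigma, tau) \in hurwitz_tuples d r)%:R : Cplx R); last first.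
  rewrite pair_bigA pair_bigA /simple_hurwitz -(sum1_card (mem (hurwitz_tuples d r))) natr_sum /=.
  by rewrite [RHS]big_mkcond; apply: eq_bigr => -[[rho sigma] tau] _ /=; case: ifP.
rewrite KsumX /Hsum mulmx_suml idcoef_sum; apply: eq_bigr => rho _.
rewrite mulmx_suml idcoef_sum; apply: eq_bigr => sigma _.
rewrite mulmx_sumr idcoef_sum big_mkcond; apply: eq_bigr => tau _.
rewrite inE -geltM idcoef_gelt; by case: (all _ _).
Qed.
End Hurwitz.

(** * Real exponential series viewed in the complex numbers *)

Section RealSeries.
Variable R : realType.
Implicit Types (x y : R) (u : R^nat).

Lemma CofRM x y : CofR (x * y) = CofR x * CofR y.
Proof. exact: (rmorphM (real_complex R)). Qed.

Lemma CofR_sum (I : Type) (s : seq I) (P : pred I) (f : I -> R) :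
  CofR (\sum_(i <- s | P i) f i) = \sum_(i <- s | P i) CofR (f i).
Proof. exact: (raddf_sum (real_complex R)). Qed.

Lemma CofRX x n : CofR (x ^+ n) = CofR x ^+ n.
Proof. exact: (rmorphXn (real_complex R)). Qed.

Lemma CofR_nat n : CofR n%:R = n%:R :> Cplx R.
Proof. exact: (rmorph_nat (real_complex R)). Qed.

Lemma CofR_int (n : int) : CofR n%:~R = n%:~R :> Cplx R.
Proof. exact: (rmorph_int (real_complex R)). Qed.

Lemma norm_CofR x : `|CofR x| = CofR `|x|.
Proof.
have := @normc_def R (x%:C)%C; rewrite /= expr0n addr0 sqrtr_sqr; exact.
Qed.

Lemma cvg_CofR u x : (u @ \oo --> x)%classic -> (@CofR R \o u @ \oo --> CofR x)%classic.
Proof.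
move=> /cvgrPdist_lt h; apply/cvgrPdist_lt => e e0.
(* A complex number that is positive for the order has zero imaginary part. *)
have [e'0 eE] : 0 < complex.Re e /\ e = CofR (complex.Re e).
  by move: e e0 => [a b]; rewrite ltcE /= => /andP[/eqP -> ->].
near=> k; rewrite eE /= /CofR.
have -> : CofR x - CofR (u k) = CofR (x - u k) by exact/esym/(rmorphB (real_complex R)).
rewrite norm_CofR [_ < _]ltcR.
by near: k; exact: h.
Unshelve. all: end_near. Qed.

Lemma series_CofR u : series (fun n => CofR (u n)) = @CofR R \o series u.
Proof. by apply/funext => n; rewrite /series /= CofR_sum. Qed.

Lemma cvg_sum_exp_coeff (I : finType) (c : R) (x : I -> R) :
  (series (fun n => c * \sum_i exp_coeff (x i) n) @ \oo --> c * \sum_i expR (x i))%classic.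
Proof.
have -> : series (fun n => c * \sum_i exp_coeff (x i) n) =
    (fun n => c * \sum_i series (exp_coeff (x i)) n).
  by apply/funext => n; rewrite /series /= -mulr_sumr exchange_big.
apply: cvgM; first exact: cvg_cst.
apply: (cvg_big (op := +%R)) => [|i _]; first exact: add_continuous.
exact: is_cvg_series_exp_coeff.
Qed.

Lemma cvg_normed_sum_exp_coeff (I : finType) (c : R) (x : I -> R) :
  cvgn (series (fun n => `|c * \sum_i exp_coeff (x i) n|)).
Proof.
apply: (@series_le_cvg _ _ (fun n => `|c| * \sum_i exp_coeff `|x i| n)) => [n|n|n|].
- exact: normr_ge0.
- rewrite mulr_ge0 // sumr_ge0 // => i _; apply: exp_coeff_ge0; exact: normr_ge0.
- rewrite normrM ler_wpM2l // (le_trans (ler_norm_sum _ _ _)) // ler_sum // => i _.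
  by rewrite /exp_coeff /= normrM normrX normfV [`|_`!%:R|]ger0_norm.
by apply/cvg_ex; eexists; exact: cvg_sum_exp_coeff.
Qed.
End RealSeries.

Local Open Scope classical_set_scope.

Theorem theorem4p5 (R : realType) (d N : nat) (t : R) :
  (1 <= d)%N -> (d <= N)%N -> 0 < t ->
  let z : R := expR (- t / 2) in
  let term (r : nat) : Cplx R :=
    CofR ((- t) ^+ r / (r`!%:R * N%:R ^+ r)) *
    idcoef (Hsum R d *m Ksum R d ^+ r) in
  [/\ cvgn [normed series term],
      cvgn (series term),
      CofR (microchiral d N t) = CofR (z ^+ d / d`!%:R) * limn (series term) &
      forall r : nat,
        idcoef (Hsum R d *m Ksum R d ^+ r) = (simple_hurwitz d r)%:R].
Proof.
move=> d1 dN t0 z term.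
have N0 : N%:R != 0 :> R by rewrite pnatr_eq0 -lt0n (leq_trans d1).
(* By [casimirE], the Boltzmann exponent of the diagram [b] is [- t * d / 2 + x b]; the first
   summand yields [z ^+ d]. *)
pose x (b : 'I_#|young d N|) : R := - t * (content_sum (row_lengths b))%:~R / N%:R.
(* The series is [d!] times a finite sum of exponential series, one for each diagram, which gives
   absolute convergence. *)
pose u (r : nat) : R := d`!%:R * \sum_b exp_coeff (x b) r.
have termE : term = (fun r => CofR (u r)).
  apply/funext => r; rewrite /term (idcoef_HK_young _ dN) /u.
  rewrite -CofR_nat; under eq_bigr do rewrite -CofR_int -CofRX.
  rewrite -CofR_sum -!CofRM mulrCA; congr (CofR (_ * _)).
  rewrite mulr_sumr; apply: eq_bigr => b _; rewrite /exp_coeff /x /=.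
  by rewrite !exprMn exprVn invfM; ring.
have u_cvg := @cvg_sum_exp_coeff R _ d`!%:R x.
have term_cvg : series term @ \oo --> CofR (d`!%:R * \sum_b expR (x b)).
  by rewrite termE series_CofR; exact: cvg_CofR.
split; last exact: idcoef_HK_hurwitz.
- have -> : [normed series term] = @CofR R \o series (fun r => `|u r|).
    by rewrite -series_CofR termE; congr series; apply/funext => r; rewrite /= norm_CofR.
  have /cvg_ex[l hl] := @cvg_normed_sum_exp_coeff R _ d`!%:R x.
  by apply/cvg_ex; exists (CofR l); exact: cvg_CofR.
- by apply/cvg_ex; eexists; exact: term_cvg.
rewrite (cvg_lim (@norm_hausdorff _ _) term_cvg) -CofRM; congr CofR.
rewrite mulrA mulfVK ?pnatr_eq0 -?lt0n ?fact_gt0 // mulr_sumr /microchiral big_enum_val.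
apply: eq_bigr => b _; rewrite (casimirE (row_lengths_young b)) -expRM_natr -expRD.
congr expR; rewrite /x rmorphD rmorphM /= -[(N * d)%N%:~R]pmulrn natrM -/(row_lengths b).
by field.
Qed.
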